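(* Let $K$ be a finite simplicial complex with a discrete Morse function and associated gradient vector field $V$. For $\alpha$ a critical $(n+1)$-simplex and $\gamma$ a critical $(n-1)$-simplex, the moduli space of flowlines $\mathcal{M}(\alpha,\gamma)$ is a simplicial manifold with boundary of dimension 1, i.e. a disjoint union of paths and cycles.
   Context: A simplicial complex $K$ is a collection of finite nonempty subsets (simplices) of a vertex set closed under taking nonempty subsets; $\sigma^{(p)}$ denotes a simplex of dimension $p$; a facet of $\sigma^{(p)}$ is a face of dimension $p-1$. A discrete Morse function is $f:K\to\mathbb{R}$ such that for each $\beta^{(p)}$ there is at most one facet $\gamma^{(p-1)}<\beta$ with $f(\gamma)\ge f(\beta)$ and at most one $\alpha^{(p+1)}>\beta$ with $f(\alpha)\le f(\beta)$. Its gradient vector field $V$ is the set of pairs $\{\sigma^{(p)}<\tau^{(p+1)}\}$ with $f(\sigma)\ge f(\tau)$; each simplex is in at most one pair. A simplex in no pair of $V$ is critical. The modified Hasse diagram has an arrow $\tau\to\sigma$ for each facet $\sigma$ of $\tau$, except that for each pair $\{\sigma<\tau\}\in V$ the arrow is reversed to $\sigma\to\tau$ (a Morse arrow). A flowline is a directed path in the modified Hasse diagram from a critical simplex $\alpha$ to a critical simplex $\gamma$; its index is $\dim\alpha-\dim\gamma$. Here ''flowline'' means flowline of index 2. Index-2 paths (possibly illegal): sequences of simplices from critical $\alpha$ to critical $\gamma$ with $\dim\alpha=\dim\gamma+2$, each step going either up along a Morse arrow or down from a simplex to one of its facets. A down step from $\tau$ to $\sigma$ with $\{\sigma<\tau\}\in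 V$ is a backward arrow. The path is illegal if it contains a backward arrow, legal otherwise; legal index-2 paths are exactly the flowlines. Such a path contains exactly one double drop (two consecutive down steps) $\alpha_i\to\beta\to\gamma_i$; $\beta$ is its intermediate simplex. A flowline is critical if its intermediate simplex is a critical simplex. Floperations: - Flop: replaces the intermediate simplex $\beta$ in the double drop $\alpha_i\to\beta\to\gamma_i$ by the unique $\beta'\ne\beta$ which is a facet of $\alpha_i$ having $\gamma_i$ as a facet. - Insert (applied to a noncritical flowline): if $\beta$ is paired in $V$ with a simplex $\delta$ (of dimension one higher or one lower), the occurrence $\beta$ of the intermediate simplex is replaced by $\beta,\delta,\beta$. - Cancel (applied to an illegal path with a backward arrow adjacent to its intermediate simplex $\beta$): that backward arrow joins $\beta$ to its $V$-partner $\delta$, and the path contains $\beta,\delta,\beta$ consecutively; this is replaced by the single $\beta$. Algorithm. $\mathrm{AlgList}_c(F)$, for a flowline $F$: begin the list with $(F,\text{c})$ and put $P:=F$. Step 1: replace $P$ by $\mathrm{Flop}(P)$. Step 2: while $P$ is illegal, replace $P$ by $\mathrm{Cancel}(P)$, append $(P,\text{c})$ to the list, and replace $P$ by $\mathrm{Flop}(P)$. Step 3: once $P$ is legal, append $(P,\text{f})$; if $P$ is critical, terminate; otherwise replace $P$ by $\mathrm{Insert}(P)$ and return to Step 1. $\mathrm{AlgList}_f(F)$, for a noncritical flowline $F$: begin the list with $(F,\text{f})$, put $P:=\mathrm{Insert}(F)$, and continue from Step 1. (The lists may be infinite if the algorithm does not terminate.) The moduli space $\mathcal{M}(\alpha,\gamma)$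 is the simplicial complex (graph) whose vertices are the flowlines $F$ from $\alpha$ to $\gamma$, and whose edges are the pairs $\{F_i,F_j\}$ of consecutive flowlines in a list $\mathrm{AlgList}_c(F)$ or $\mathrm{AlgList}_f(F)$ for some flowline $F$ from $\alpha$ to $\gamma$. *)

(* Defs.v *)
From HB Require Import structures.
From mathcomp Require Import all_boot all_order all_algebra.
From mathcomp Require Import finmap reals.

Set Implicit Arguments.
Unset Strict Implicit.
Unset Printing Implicit Defensive.

Import Order.TTheory GRing.Theory Num.Theory.

Local Open Scope fset_scope.
Local Open Scope ring_scope.

(* A simplicial complex is a predicate on finite sets of vertices, so that the
   same notion applies to the finite complex K and to the moduli space, whose
   finiteness is not known a priori. *)
Definition simplicial_complex (W : choiceType) (C : {fset W} -> Prop) : Prop :=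
  (forall s, C s -> s != fset0) /\
  (forall s t, C s -> t `<=` s -> t != fset0 -> C t).

(* Only meaningful on nonempty sets: for fset0 it is 0 instead of -1. *)
Definition sdim (W : choiceType) (s : {fset W}) : nat := #|` s|.-1.

(* The link of a vertex must be a 0-sphere (two points) or a 0-ball (one
   point); in particular there are no isolated vertices and no simplices of
   dimension greater than 1. *)
Definition link (W : choiceType) (C : {fset W} -> Prop) (v : W) :
    {fset W} -> Prop :=
  fun t => [/\ C t, v \notin t & C (v |` t)].

Definition simplicial_1manifold_with_boundary
    (W : choiceType) (C : {fset W} -> Prop) : Prop :=
  simplicial_complex C /\
  forall v, C [fset v] ->
    (exists w, forall t, link C v t <-> t = [fset w]) \/
    (exists w1 w2, w1 != w2 /\
       forall t, link C v t <-> t = [fset w1] \/ t = [fset w2]).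

Definition path_complex (W : choiceType) (p : seq W) : {fset W} -> Prop :=
  fun s => (exists2 v, v \in p & s = [fset v]) \/
    exists p1 u v p2, p = p1 ++ [:: u, v & p2] /\ s = [fset u; v].

(* [next c u] is the cyclic successor of [u] in [c]. *)
Definition cycle_complex (W : choiceType) (c : seq W) : {fset W} -> Prop :=
  fun s => exists2 u, u \in c & s = [fset u] \/ s = [fset u; next c u].

Definition disjoint_union_of_paths_and_cycles
    (W : choiceType) (C : {fset W} -> Prop) : Prop :=
  exists ps cs : seq (seq W),
    [/\ (forall p, p \in ps -> (2 <= size p)%N),
        (forall c, c \in cs -> (3 <= size c)%N),
        uniq (flatten (ps ++ cs)) &
        forall s, C s <-> (exists2 p, p \in ps & path_complex p s) \/
                          (exists2 c, c \in cs & cycle_complex c s)].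

Definition facet (T : choiceType) (K : {fset {fset T}})
    (sigma tau : {fset T}) : bool :=
  [&& sigma \in K, tau \in K, sigma `<=` tau & sdim tau == (sdim sigma).+1].

(* The values of f outside K are irrelevant. *)
Definition discrete_morse (R : realType) (T : choiceType)
    (K : {fset {fset T}}) (f : {fset T} -> R) : Prop :=
  forall beta, beta \in K ->
    (forall g1 g2, facet K g1 beta -> facet K g2 beta ->
       f beta <= f g1 -> f beta <= f g2 -> g1 = g2) /\
    (forall a1 a2, facet K beta a1 -> facet K beta a2 ->
       f a1 <= f beta -> f a2 <= f beta -> a1 = a2).

Definition gradient (R : realType) (T : choiceType)
    (K : {fset {fset T}}) (f : {fset T} -> R) (sigma tau : {fset T}) : bool :=
  facet K sigma tau && (f tau <= f sigma).

Definition paired (R : realType) (T : choiceType)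
    (K : {fset {fset T}}) (f : {fset T} -> R) (sigma tau : {fset T}) : bool :=
  gradient K f sigma tau || gradient K f tau sigma.

Definition critical (R : realType) (T : choiceType)
    (K : {fset {fset T}}) (f : {fset T} -> R) (sigma : {fset T}) : bool :=
  (sigma \in K) && [forall tau : K, ~~ paired K f sigma (val tau)].

Definition hasse_arrow (R : realType) (T : choiceType)
    (K : {fset {fset T}}) (f : {fset T} -> R) (sigma tau : {fset T}) : bool :=
  (facet K tau sigma && ~~ gradient K f tau sigma) || gradient K f sigma tau.

Definition is_flowline (R : realType) (T : choiceType)
    (K : {fset {fset T}}) (f : {fset T} -> R) (alpha gamma : {fset T})
    (P : seq {fset T}) : bool :=
  [&& critical K f alpha, critical K f gamma, sdim alpha == (sdim gamma).+2 &
      if P is a :: p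
      then [&& a == alpha, path (hasse_arrow K f) a p & last a p == gamma]
      else false].

Definition flowline (R : realType) (T : choiceType)
    (K : {fset {fset T}}) (f : {fset T} -> R) (alpha gamma : {fset T}) :=
  {P : seq {fset T} | is_flowline K f alpha gamma P}.

(* The definitions below are used on (possibly illegal) index-2 paths, which
   have exactly one double drop a -> b -> c; this makes the floperations
   below single-valued there. *)
Definition double_drop (T : choiceType) (K : {fset {fset T}})
    (a b c : {fset T}) : bool :=
  facet K b a && facet K c b.

Definition critical_path (R : realType) (T : choiceType)
    (K : {fset {fset T}}) (f : {fset T} -> R) (P : seq {fset T}) : Prop :=
  exists p1 a b c p2,
    [/\ P = p1 ++ [:: a, b, c & p2], double_drop K a b c & critical K f b].

Definition illegal (R : realType) (T : choiceType)
    (K : {fset {fset T}}) (f : {fset T} -> R) (P : seq {fset T}) : Prop :=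
  exists p1 tau sigma p2,
    P = p1 ++ [:: tau, sigma & p2] /\ gradient K f sigma tau.

Inductive flop (T : choiceType) (K : {fset {fset T}}) :
    seq {fset T} -> seq {fset T} -> Prop :=
| Flop p1 a b c p2 b' :
    double_drop K a b c -> double_drop K a b' c -> b' != b ->
    flop K (p1 ++ [:: a, b, c & p2]) (p1 ++ [:: a, b', c & p2]).

Inductive insert (R : realType) (T : choiceType)
    (K : {fset {fset T}}) (f : {fset T} -> R) :
    seq {fset T} -> seq {fset T} -> Prop :=
| Insert p1 a b c p2 delta :
    double_drop K a b c -> paired K f b delta ->
    insert K f (p1 ++ [:: a, b, c & p2]) (p1 ++ [:: a, b, delta, b, c & p2]).

(* The backward arrow next to the intermediate simplex b is either the first
   (a -> b) or the second (b -> c) step of the double drop; the partner of b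
   is then a, respectively c. *)
Inductive cancel_pair (R : realType) (T : choiceType)
    (K : {fset {fset T}}) (f : {fset T} -> R) :
    seq {fset T} -> seq {fset T} -> Prop :=
| CancelFirst p1 a b c p2 :
    double_drop K a b c -> gradient K f b a ->
    cancel_pair K f (p1 ++ [:: b, a, b, c & p2]) (p1 ++ [:: b, c & p2])
| CancelSecond p1 a b c p2 :
    double_drop K a b c -> gradient K f c b ->
    cancel_pair K f (p1 ++ [:: a, b, c, b & p2]) (p1 ++ [:: a, b & p2]).

Inductive tag := tag_c | tag_f.

(* [first_appended K f P e]: e is the first entry appended to the list when
   Step 1 of the algorithm is entered with the path P. *)
Inductive first_appended (R : realType) (T : choiceType)
    (K : {fset {fset T}}) (f : {fset T} -> R) (P : seq {fset T}) :
    seq {fset T} * tag -> Prop :=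
| AppendedIllegal Q Q' :
    flop K P Q -> illegal K f Q -> cancel_pair K f Q Q' ->
    first_appended K f P (Q', tag_c)
| AppendedLegal Q :
    flop K P Q -> ~ illegal K f Q ->
    first_appended K f P (Q, tag_f).

(* After appending (P, c) the algorithm flops P and tests legality, exactly as
   on entering Step 1; after appending (P, f) it stops if P is critical and
   otherwise enters Step 1 with Insert(P). *)
Inductive alg_next (R : realType) (T : choiceType)
    (K : {fset {fset T}}) (f : {fset T} -> R) :
    seq {fset T} * tag -> seq {fset T} * tag -> Prop :=
| NextC P e :
    first_appended K f P e -> alg_next K f (P, tag_c) e
| NextF P P' e :
    ~ critical_path K f P -> insert K f P P' -> first_appended K f P' e ->
    alg_next K f (P, tag_f) e.

(* [L] is the possibly infinite list produced by the algorithm from the first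
   entry [e0]; [L i = None] past the end of the list. *)
Definition is_alg_list (R : realType) (T : choiceType)
    (K : {fset {fset T}}) (f : {fset T} -> R) (e0 : seq {fset T} * tag)
    (L : nat -> option (seq {fset T} * tag)) : Prop :=
  L 0%N = Some e0 /\
  forall i, match L i, L i.+1 with
            | Some e, Some e' => alg_next K f e e'
            | Some e, None => ~ exists e', alg_next K f e e'
            | None, next_entry => next_entry = None
            end.

Definition is_AlgList_c (R : realType) (T : choiceType)
    (K : {fset {fset T}}) (f : {fset T} -> R) (F : seq {fset T})
    (L : nat -> option (seq {fset T} * tag)) : Prop :=
  is_alg_list K f (F, tag_c) L.

Definition is_AlgList_f (R : realType) (T : choiceType)
    (K : {fset {fset T}}) (f : {fset T} -> R) (F : seq {fset T})
    (L : nat -> option (seq {fset T} * tag)) : Prop :=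
  ~ critical_path K f F /\ is_alg_list K f (F, tag_f) L.

Definition consecutive_flowlines (R : realType) (T : choiceType)
    (K : {fset {fset T}}) (f : {fset T} -> R) (alpha gamma : {fset T})
    (F1 F2 : flowline K f alpha gamma) : Prop :=
  exists (F : flowline K f alpha gamma) L i t1 t2,
    [/\ is_AlgList_c K f (val F) L \/ is_AlgList_f K f (val F) L,
        L i = Some (val F1, t1) & L i.+1 = Some (val F2, t2)].

Definition moduli_space (R : realType) (T : choiceType)
    (K : {fset {fset T}}) (f : {fset T} -> R) (alpha gamma : {fset T}) :
    {fset flowline K f alpha gamma} -> Prop :=
  fun s => (exists F, s = [fset F]) \/
    exists F1 F2, consecutive_flowlines F1 F2 /\ s = [fset F1; F2].

(* Main.v *)
Require Import Defs.
From mathcomp Require Import all_boot all_order all_algebra.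
From mathcomp Require Import finmap reals.
From mathcomp Require Import boolp zify.

(** Along a path of simplices two Morse arrows are never consecutive
    ([gradient_chain]), and a path between critical simplices starts and ends
    with a down step.  Hence a path of index two has exactly one double drop
    ([double_drop_exists], [double_drop_uniq]), and every floperation has at
    most one result on it.

    Call a path from [alpha] to [gamma] a near-flowline when it is legal except
    perhaps at the two steps of its double drop.  Flop is an involution without
    fixed points on near-flowlines, since exactly two simplices lie between two
    simplices whose dimensions differ by two ([double_drop_swap],
    [double_drop_swap_uniq]).  A legal near-flowline is a flowline; Insert and
    Cancel are inverse bijections between noncritical flowlines and illegal
    near-flowlines ([insert_near], [cancel_flowline], [illegal_cancel]).  So each
    flowline [F] has one or two ends, namely the near-flowline [F] and, when [F]
    is noncritical, the near-flowline Insert [F], and every near-flowline is an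
    end of exactly one flowline ([near_end_path], [end_path_flowline]).

    The algorithm leaves a flowline through one end, flops, and enters the
    flowline that owns the end so reached; the tag of an entry names the end
    through which it will be left.  The edges of the moduli space are therefore
    the pairs of flowlines that own [P] and Flop [P], for [P] a near-flowline
    ([alg_nextP], [consecutive_end_edge]).  Each flowline has one or two
    neighbours, as it has one or two ends.  It is not its own neighbour, because
    its two ends have different lengths whereas Flop preserves the length
    ([end_edge_irr]).

    There are finitely many flowlines: an arrow that goes down decreases the
    values of the Morse function, and a Morse arrow does not increase them but
    raises the dimension, so a path of arrows never repeats a simplex
    ([arrow_path_uniq]).  Finally, in a finite graph all of whose degrees are one
    or two, the vertices of a longest simple path form a component, which is a
    path or a cycle; removing components one after the other gives the
    decomposition ([graph_complex_decomposition]). *)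

Set Implicit Arguments.
Unset Strict Implicit.
Unset Printing Implicit Defensive.

Import Order.TTheory.

Local Open Scope fset_scope.

(** * Finite graphs whose degrees are one or two *)

(* [lia] takes the sizes of a sequence over a choiceType and over its eqType for
   different terms; simplification identifies them. *)
Ltac size_lia := simpl in *; lia.

Section DegreeTwoGraph.

Variables (W : choiceType) (e : rel W).
Hypothesis e_sym : symmetric e.
Hypothesis e_irr : irreflexive e.
Hypothesis e_deg_gt0 : forall v, exists w, e v w.
Hypothesis e_deg_le2 :
  forall v a b c, e v a -> e v b -> e v c -> [|| a == b, a == c | b == c].

Definition edge_closed (V : seq W) := forall v w, v \in V -> e v w -> w \in V.

Definition graph_complex (V : seq W) (s : {fset W}) : Prop :=
  (exists2 v, v \in V & s = [fset v]) \/
  exists u v, [/\ u \in V, e u v & s = [fset u; v]].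

Lemma two_nbrs (x0 : W) (s : seq W) i j k w : uniq s ->
  i < size s -> j < size s -> i != j ->
  e k (nth x0 s i) -> e k (nth x0 s j) -> e k w ->
  w = nth x0 s i \/ w = nth x0 s j.
Proof.
move=> us ltis ltjs neij eki ekj ekw.
have := e_deg_le2 eki ekj ekw; rewrite nth_uniq // (negPf neij) /=.
by case/orP=> /eqP <-; [left | right].
Qed.

(** An inner vertex of the path already has its two neighbours on the path, next
    to it; so only the two ends of the path can be joined by a further edge. *)
Lemma path_chord (x0 : W) (s : seq W) i j :
  sorted e s -> uniq s -> i < j -> j < size s ->
  e (nth x0 s i) (nth x0 s j) -> j = i.+1 \/ i = 0 /\ j = (size s).-1.
Proof.
move=> /(sortedP x0) ps us ltij ltjs eij.
case: (eqVneq j i.+1) => [|nej]; first by left.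
right; split.
- case: i ltij eij nej => // i ltij eij nej; exfalso.
  have e1 : e (nth x0 s i.+1) (nth x0 s i) by rewrite e_sym ps //; size_lia.
  have e2 : e (nth x0 s i.+1) (nth x0 s i.+2) by rewrite ps //; size_lia.
  have [| | |/eqP|/eqP] := @two_nbrs x0 s i i.+2 _ _ us _ _ _ e1 e2 eij;
    rewrite ?nth_uniq //; size_lia.
- case: (ltnP j (size s).-1) => [ltjs'|]; last by size_lia.
  case: j ltij ltjs ltjs' eij nej => // j ltij ltjs ltjs' eij nej; exfalso.
  have e1 : e (nth x0 s j.+1) (nth x0 s j) by rewrite e_sym ps //; size_lia.
  have e2 : e (nth x0 s j.+1) (nth x0 s j.+2) by rewrite ps //; size_lia.
  rewrite e_sym in eij.
  have [| | |/eqP|/eqP] := @two_nbrs x0 s j j.+2 _ _ us _ _ _ e1 e2 eij;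
    rewrite ?nth_uniq //; size_lia.
Qed.

Definition simple_path (V s : seq W) :=
  [&& sorted e s, uniq s & all [in V] s].

Lemma longest_simple_path (V : seq W) : 0 < size V ->
  exists2 s, simple_path V s & 0 < size s /\
    forall s', simple_path V s' -> size s' <= size s.
Proof.
case: V => // v V _; set V' := v :: V.
pose P n := `[< exists2 s, simple_path V' s & size s = n >].
have exP : exists n, P n.
  by exists 1; apply/asboolP; exists [:: v]; rewrite // /simple_path /= mem_head.
have ubP n : P n -> n <= size V'.
  move=> /asboolP[s /and3P[_ us /allP sV] <-].
  exact: uniq_leq_size.
case: (ex_maxnP exP ubP) => n /asboolP[s us <-] maxs.
have maxs' s' : simple_path V' s' -> size s' <= size s.
  by move=> us'; apply: maxs; apply/asboolP; exists s'.
exists s => //; split=> //.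
by apply: (maxs' [:: v]); rewrite /simple_path /= mem_head.
Qed.

(** A neighbour outside of the path would be a third neighbour of an inner vertex,
    or would extend the path at one of its ends. *)
Lemma longest_simple_path_closed (V s : seq W) :
  edge_closed V -> simple_path V s ->
  (forall s', simple_path V s' -> size s' <= size s) -> edge_closed s.
Proof.
move=> clV us maxs v w vs evw; have /and3P[ps uqs /allP sV] := us.
have wV : w \in V by apply: clV evw; apply: sV.
have := vs; rewrite -index_mem; set i := index v s => ltis.
have vE : nth v s i = v by rewrite nth_index.
apply: contraT => ws.
have i_gt0 : i != 0.
  apply/eqP=> i0; suff /maxs : simple_path V (w :: s) by rewrite /= ltnn.
  rewrite /simple_path /= ws uqs wV /= (introT allP sV) andbT.
  case: (s) i0 vE ps => //= y s' i0; rewrite i0 /= => -> ->.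
  by rewrite e_sym evw.
have i_lt : i.+1 < size s.
  case: (ltnP i.+1 (size s)) => // lei; have iE : i = (size s).-1 by size_lia.
  suff /maxs : simple_path V (rcons s w) by rewrite size_rcons ltnn.
  rewrite /simple_path rcons_uniq ws uqs all_rcons wV (introT allP sV) /= andbT.
  move: vE; rewrite iE nth_last; case: (s) ps => //= y s' ps vE.
  by rewrite rcons_path ps vE evw.
move/(sortedP v): ps => ps.
have e1 : e v (nth v s i.-1).
  by have := ps i.-1; rewrite prednK ?lt0n // vE e_sym => ->.
have e2 : e v (nth v s i.+1) by have := ps i i_lt; rewrite vE.
have [| | |E|E] := @two_nbrs v s i.-1 i.+1 _ _ uqs _ _ _ e1 e2 evw;
  try size_lia; by rewrite E mem_nth // in ws; size_lia.
Qed.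

Lemma path_complexP (x0 : W) (p : seq W) t :
  path_complex p t <-> (exists2 v, v \in p & t = [fset v]) \/
  exists2 i, i.+1 < size p & t = [fset nth x0 p i; nth x0 p i.+1].
Proof.
split=> [[[v vp ->]|[p1 [u [v [p2 [-> ->]]]]]]|[[v vp ->]|[i lti ->]]].
- by left; exists v.
- right; exists (size p1); first by rewrite size_cat /=; size_lia.
  by rewrite !nth_cat ltnn subnn ifN ?subSnn //; size_lia.
- by left; exists v.
- right; exists (take i p), (nth x0 p i), (nth x0 p i.+1), (drop i.+2 p).
  by rewrite -!drop_nth ?cat_take_drop //; size_lia.
Qed.

Lemma next_nthE (x0 : W) (c : seq W) i : uniq c -> i < size c ->
  next c (nth x0 c i) =
  if i.+1 < size c then nth x0 c i.+1 else nth x0 c 0.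
Proof.
move=> uc lti; rewrite next_nth mem_nth //.
case: c uc lti => // y p uc lti; rewrite index_uniq //=.
case: ltnP => lei; first by rewrite (set_nth_default x0) //; size_lia.
by rewrite nth_default //; size_lia.
Qed.

Lemma cycle_complexP (x0 : W) (c : seq W) t : uniq c -> 0 < size c ->
  cycle_complex c t <-> path_complex c t \/
    t = [fset nth x0 c (size c).-1; nth x0 c 0].
Proof.
move=> uc c_gt0; rewrite (path_complexP x0).
split=> [[u uc' [->|->]]|[[[v vc ->]|[i lti ->]]|->]].
- by left; left; exists u.
- rewrite -(nth_index x0 uc') next_nthE ?index_mem //.
  case: ltnP => lei; first by left; right; exists (index u c).
  right; have := uc'; rewrite -index_mem => lti.
  by have -> : index u c = (size c).-1 by size_lia.
- by exists v => //; left.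
- exists (nth x0 c i); first by rewrite mem_nth //; size_lia.
  by right; rewrite next_nthE ?lti //; size_lia.
- exists (nth x0 c (size c).-1); first by rewrite mem_nth //; size_lia.
  by right; rewrite next_nthE // ?ifN //; size_lia.
Qed.

(** By [path_chord] the edges on a simple path are its steps and possibly an edge
    between its ends; the latter closes a cycle when there are at least three
    vertices. *)
Lemma component_complex (s : seq W) :
  sorted e s -> uniq s -> 0 < size s -> edge_closed s ->
  1 < size s /\
  ((forall t, graph_complex s t <-> path_complex s t) \/
   2 < size s /\ forall t, graph_complex s t <-> cycle_complex s t).
Proof.
case: s => // x0 s0; set s := x0 :: s0 => ps us s_gt0 cls.
have s_gt1 : 1 < size s.
  have [w ew] := e_deg_gt0 x0.
  have : w \in s by apply: cls ew; exact: mem_head.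
  rewrite inE; case/orP => [/eqP E|]; first by rewrite E e_irr in ew.
  by rewrite /s /=; case: (s0).
have edgeE t : graph_complex s t <->
    path_complex s t \/ e (nth x0 s (size s).-1) (nth x0 s 0) /\
                        t = [fset nth x0 s (size s).-1; nth x0 s 0].
  rewrite (path_complexP x0); split; last first.
    case=> [[[v vs ->]|[i lti ->]]|[E ->]].
    - by left; exists v.
    - right; exists (nth x0 s i), (nth x0 s i.+1); split=> //.
        by rewrite mem_nth //; size_lia.
      by move/(sortedP x0): ps; apply.
    - right; exists (nth x0 s (size s).-1), (nth x0 s 0); split=> //.
      by rewrite mem_nth //; size_lia.
  case=> [[v vs ->]|[u [v [us' euv ->]]]]; first by left; left; exists v.
  have vs : v \in s by apply: cls euv.
  wlog : u v us' vs euv / index u s < index v s => [wl|ltuv].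
    case: (ltngtP (index u s) (index v s)) => [||E]; first exact: wl.
      by move=> lt; rewrite fsetUC; apply: wl => //; rewrite e_sym.
    have E' : u = v by rewrite -(nth_index x0 us') E nth_index.
    by rewrite E' e_irr in euv.
  have := euv; rewrite -(nth_index x0 us') -(nth_index x0 vs) => E.
  have := vs; rewrite -index_mem => ltv.
  case: (path_chord ps us ltuv ltv E) => [vE|[u0 vE]].
  - by left; right; exists (index u s); rewrite -?vE.
  - by right; rewrite fsetUC -u0 -vE e_sym.
split=> //; case: (boolP ((2 < size s) &&
    e (nth x0 s (size s).-1) (nth x0 s 0))) => [/andP[lt2 E]|short].
  right; split=> // t; rewrite edgeE (cycle_complexP x0) //.
  by split=> [[|[]]|[|]]; auto.
left=> t; rewrite edgeE; split=> [[//|[E ->]]|]; last by left.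
rewrite E andbT -leqNgt in short.
(* in a path with two vertices the edge joining the ends is the only step *)
have -> : (size s).-1 = 1 by size_lia.
by apply/(path_complexP x0); right; exists 0 => //; rewrite fsetUC.
Qed.

(** Induction on the number of vertices: the vertices of a longest simple path are
    a component, and the remaining vertices are again closed under adjacency. *)
Lemma graph_complex_decomposition (V : seq W) : edge_closed V ->
  exists ps cs : seq (seq W),
    [/\ forall p, p \in ps -> 2 <= size p,
        forall c, c \in cs -> 3 <= size c,
        uniq (flatten (ps ++ cs)), {subset flatten (ps ++ cs) <= V} &
        forall s, graph_complex V s <-> (exists2 p, p \in ps & path_complex p s)
                    \/ (exists2 c, c \in cs & cycle_complex c s)].
Proof.
have [n] := ubnP (size V); elim: n V => // n IH V ltVn clV.
have [V0|V_gt0] := posnP (size V).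
  exists [::], [::]; split=> // s; split; case=> [[v]|];
    rewrite ?(size0nil V0) //.
  - by case=> v [w []].
  - by case.
have [s us [s_gt0 maxs]] := longest_simple_path V_gt0.
have /and3P[ps uqs /allP sV] := us.
have cls := longest_simple_path_closed clV us maxs.
have [s_gt1 compS] := component_complex ps uqs s_gt0 cls.
pose V' := [seq v <- V | v \notin s].
have clV' : edge_closed V'.
  move=> v w; rewrite !mem_filter => /andP[vs vV] evw.
  rewrite (clV v w) // andbT; apply: contra vs => ws.
  by apply: (cls w) => //; rewrite e_sym.
have ltV' : size V' < n.
  apply: leq_trans (_ : size V <= n); last by [].
  rewrite size_filter -(count_predC (mem s) V) -[ltnLHS]add0n ltn_add2r.
  rewrite -has_count; apply/hasP; case: (s) s_gt0 sV => // x s' _ sV'.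
  by exists x; rewrite ?sV' ?inE ?eqxx.
have [ps' [cs' [ps2 cs3 uq sub compE]]] := IH V' ltV' clV'.
have VE t : graph_complex V t <-> graph_complex s t \/ graph_complex V' t.
  split; last first.
    case=> [[[v vs ->]|[u [v [us' euv ->]]]]|[[v vs ->]|[u [v [us' euv ->]]]]].
    - by left; exists v; rewrite ?sV.
    - by right; exists u, v; rewrite sV.
    - by left; exists v => //; move: vs; rewrite mem_filter => /andP[].
    - by right; exists u, v; move: us'; rewrite mem_filter => /andP[].
  case=> [[v vV ->]|[u [v [uV euv ->]]]].
  - case: (boolP (v \in s)) => vs; first by left; left; exists v.
    by right; left; exists v; rewrite // mem_filter vs.
  - case: (boolP (u \in s)) => vs; first by left; right; exists u, v.
    by right; right; exists u, v; rewrite // mem_filter vs.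
have disj : ~~ has (in_mem^~ (mem s)) (flatten (ps' ++ cs')).
  apply/hasP=> -[x /sub]; rewrite mem_filter => /andP[xs _].
  by rewrite /= (negPf xs).
have sub' : {subset s ++ flatten (ps' ++ cs') <= V}.
  move=> x; rewrite mem_cat => /orP[/sV //|/sub].
  by rewrite mem_filter => /andP[].
have uq' : uniq (s ++ flatten (ps' ++ cs')) by rewrite cat_uniq uqs disj uq.
case: compS => [pE|[lt2 cE]].
- exists (s :: ps'), cs'; split=> //.
    by move=> p; rewrite inE => /orP[/eqP->|/ps2].
  move=> t; rewrite VE pE compE; split.
  + case=> [H|[[p pp H]|H]]; [left|left|by right].
      by exists s; rewrite ?mem_head.
    by exists p; rewrite // inE pp orbT.
  + case=> [[p]|H]; last by right; right.
    by rewrite inE => /orP[/eqP->|pp H]; [left|right; left; exists p].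
- exists ps', (s :: cs').
  have perm : perm_eq (flatten (ps' ++ s :: cs')) (s ++ flatten (ps' ++ cs')).
    by rewrite !flatten_cat /= perm_catCA.
  split=> //.
  + by move=> c; rewrite inE => /orP[/eqP->|/cs3].
  + by rewrite (perm_uniq perm).
  + by move=> x; rewrite (perm_mem perm); apply: sub'.
  move=> t; rewrite VE cE compE; split.
  + case=> [H|[H|[c cc H]]]; [right|by left|right].
      by exists s; rewrite ?mem_head.
    by exists c; rewrite // inE cc orbT.
  + case=> [H|[c]]; first by right; left.
    by rewrite inE => /orP[/eqP->|cc H]; [left|right; right; exists c].
Qed.

Lemma edge_neq u v : e u v -> u != v.
Proof. by apply: contraTneq => ->; rewrite e_irr. Qed.

Lemma graph_complex_link (V : seq W) v t : edge_closed V -> v \in V ->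
  link (graph_complex V) v t <-> exists2 w, e v w & t = [fset w].
Proof.
move=> clV vV; split; last first.
  case=> w evw ->; split.
  - by left; exists w => //; apply: clV evw.
  - by rewrite inE edge_neq.
  - by right; exists v, w.
have edgeP a w : e a w -> a \notin t -> [fset a; w] = a |` t -> t = [fset w].
  move=> eaw at_ E; rewrite -(fsetU1K at_) -E fsetU1K // inE.
  exact: edge_neq.
case=> Ct vt [[u uV E]|[a [b [aV eab E]]]].
- have [x xt] : exists x, x \in t.
    by case: Ct => [[x _ ->]|[x [y [_ _ ->]]]]; exists x; rewrite !inE eqxx.
  have vu : v = u by apply/fset1P; rewrite -E fset1U1.
  have xu : x = u by apply/fset1P; rewrite -E fset1Ur.
  by rewrite vu -xu xt in vt.
- have : v \in [fset a; b] by rewrite -E fset1U1.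
  case/fset2P => vE; rewrite vE in vt E.
    by exists b; [rewrite vE | apply: (edgeP a)].
  exists a; first by rewrite vE e_sym.
  by apply: (edgeP b) => //; [rewrite e_sym | rewrite fsetUC].
Qed.

Lemma graph_complex_1manifold (V : seq W) : edge_closed V ->
  simplicial_1manifold_with_boundary (graph_complex V).
Proof.
move=> clV; split; first split.
- by move=> s [[v _ ->]|[u [v [_ _ ->]]]]; apply/fset0Pn; [exists v|exists u];
    rewrite !inE eqxx.
- move=> s t [[v vV ->]|[u [v [uV euv ->]]]] /fsubsetP sub /fset0Pn[x xt].
    left; exists v => //; apply/fsetP => y; rewrite inE.
    apply/idP/eqP => [/sub/fset1P //|->].
    by have /sub/fset1P <- := xt.
  have vV := clV _ _ uV euv.
  case: (boolP (u \in t)) => ut; case: (boolP (v \in t)) => vt.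
  + right; exists u, v; split=> //; apply/fsetP => y.
    apply/idP/idP => [/sub //|].
    by case/fset2P => ->.
  + left; exists u => //; apply/fsetP => y; rewrite inE.
    apply/idP/eqP => [yt|-> //].
    by case/fset2P: (sub y yt) => // yE; rewrite -yE yt in vt.
  + left; exists v => //; apply/fsetP => y; rewrite inE.
    apply/idP/eqP => [yt|-> //].
    by case/fset2P: (sub y yt) => // yE; rewrite -yE yt in ut.
  + by case/fset2P: (sub x xt) => xE; rewrite -xE xt in ut vt.
move=> v Cv.
have vV : v \in V.
  case: Cv => [[w wV /fset1_inj-> //]|[a [b [aV /edge_neq ne E]]]].
  have : a \in [fset v] by rewrite E !inE eqxx.
  by move=> /fset1P <-.
have [w1 e1] := e_deg_gt0 v.
case: (pselect (exists2 w2, w1 != w2 & e v w2)) => [[w2 ne e2]|none].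
- right; exists w1, w2; split=> // t; rewrite graph_complex_link //.
  split=> [[w ew ->]|[->|->]]; [|by exists w1|by exists w2].
  have := e_deg_le2 e1 e2 ew; rewrite (negPf ne) /=.
  by case/orP=> /eqP->; [left|right].
- left; exists w1 => t; rewrite graph_complex_link //.
  split=> [[w ew ->]|->]; last by exists w1.
  case: (eqVneq w1 w) => [-> //|ne].
  by case: none; exists w.
Qed.

End DegreeTwoGraph.

(** * Facets and gradient pairs *)

Section MorsePaths.

Variables (R : realType) (T : choiceType) (K : {fset {fset T}}).
Variable f : {fset T} -> R.
Hypothesis hK : simplicial_complex (fun s => s \in K).
Hypothesis hf : discrete_morse K f.

Local Notation facet := (facet K).
Local Notation double_drop := (double_drop K).
Local Notation gradient := (gradient K f).
Local Notation paired := (paired K f).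
Local Notation arrow := (hasse_arrow K f).
Local Notation critical := (critical K f).
Local Notation illegal := (illegal K f).

Lemma facet_dim s t : facet s t -> sdim t = (sdim s).+1.
Proof. by case/and4P=> _ _ _ /eqP. Qed.

Lemma card_simplex s : s \in K -> #|` s| = (sdim s).+1.
Proof. by case: hK => h _ /h; rewrite -cardfs_gt0 /sdim; lia. Qed.

Lemma facetP s t : reflect
  [/\ s \in K, t \in K & exists2 x, x \notin s & t = x |` s] (facet s t).
Proof.
apply: (iffP and4P) => [[sK tK sub /eqP E]|[sK tK [x xs tE]]].
  split=> //; have /eqP/cardfs1P[x xE] : #|` t `\` s| = 1.
    by rewrite cardfsDS // !card_simplex // E; lia.
  have : x \in t `\` s by rewrite xE inE.
  rewrite inE => /andP[xs xt]; exists x => //.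
  by rewrite -xE -[LHS](fsetID s t) (fsetIidPr sub) fsetUC.
split=> //; first by rewrite tE fsubsetU1.
have := card_simplex tK; rewrite tE cardfsU1 xs /= card_simplex // => -[E].
by rewrite -E.
Qed.

(** If [b] is [c] with [x] added and [a] is [b] with [y] added, the other simplex
    is [c] with [y] added. *)
Lemma double_drop_swap a b c : double_drop a b c ->
  exists2 b', b' != b & double_drop a b' c.
Proof.
case/andP=> /facetP[bK aK [y yb aE]] /facetP[cK _ [x xc bE]].
move: yb; rewrite bE !inE => /norP[nyx yc].
have b'K : (y |` c) \in K.
  case: hK => _ h; apply: (h a) => //.
    by rewrite aE bE fsetUCA fsubsetU1.
  by apply/fset0Pn; exists y; rewrite !inE eqxx.
exists (y |` c).
  by apply/eqP => /fsetP/(_ y); rewrite !inE eqxx (negPf nyx) (negPf yc).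
apply/andP; split; apply/facetP; split=> //; last by exists y.
exists x; first by rewrite !inE eq_sym (negPf nyx).
by rewrite aE bE fsetUCA.
Qed.

Lemma double_drop_swap_uniq a b c b1 b2 : double_drop a b c ->
  double_drop a b1 c -> b1 != b -> double_drop a b2 c -> b2 != b -> b1 = b2.
Proof.
case/andP=> /facetP[bK aK [y yb aE]] /facetP[cK _ [x xc bE]].
suff swapE b' : double_drop a b' c -> b' != b -> b' = y |` c.
  by move=> /swapE/[apply] -> /swapE/[apply] ->.
case/andP=> /and4P[_ _ b'a _] /facetP[_ _ [z zc b'E]].
have /(fsubsetP b'a) : z \in b' by rewrite b'E fset1U1.
rewrite aE bE !inE (negPf zc) orbF b'E.
by case/orP=> /eqP-> //; rewrite eqxx.
Qed.

Lemma gradient_facet s t : gradient s t -> facet s t.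
Proof. by case/andP. Qed.

(** Let [w] be the other simplex between [x] and [z].  The facet [y] is the
    exceptional one of [z] and the exceptional coface of [x], so that
    f x < f w < f z, whereas the two pairs give f z <= f y <= f x. *)
Lemma gradient_chain x y z : gradient x y -> gradient y z -> False.
Proof.
case/andP=> xy fyx /andP[yz fzy].
have [|w nwy /andP[wz xw]] := @double_drop_swap z y x; first by apply/andP.
have /facetP[xK _ _] := xy; have /facetP[_ zK _] := yz.
have fwz : (f w < f z)%R.
  rewrite ltNge; apply: contra nwy => fzw.
  by have [h _] := hf zK; rewrite (h w y).
have fxw : (f x < f w)%R.
  rewrite ltNge; apply: contra nwy => fwx.
  by have [_ h] := hf xK; rewrite (h w y).
have := lt_trans fxw fwz; rewrite ltNge => /negP; apply.
exact: le_trans fzy fyx.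
Qed.

Lemma gradient_up_inj x y z : gradient x y -> gradient x z -> y = z.
Proof.
case/andP=> xy fyx /andP[xz fzx]; have /facetP[xK _ _] := xy.
by have [_ h] := hf xK; apply: h.
Qed.

Lemma gradient_down_inj x y z : gradient x z -> gradient y z -> x = y.
Proof.
case/andP=> xz fzx /andP[yz fzy]; have /facetP[_ zK _] := xz.
by have [h _] := hf zK; apply: h.
Qed.

Lemma paired_inj b d1 d2 : paired b d1 -> paired b d2 -> d1 = d2.
Proof.
case/orP=> [u1|v1] /orP[u2|v2].
- exact: gradient_up_inj u1 u2.
- by case: (gradient_chain v2 u1).
- by case: (gradient_chain v1 u2).
- exact: gradient_down_inj v1 v2.
Qed.

Lemma critical_unpaired s t : critical s -> paired s t = false.
Proof.
case/andP=> _ /forallP h; apply/negP=> p.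
have tK : t \in K by case/orP: p => /gradient_facet/facetP[].
by have := h [`tK]; rewrite /= p.
Qed.

(** * Double drops *)

(** The steps of possibly illegal paths: down to any facet, or up a Morse arrow. *)
Definition step : rel {fset T} := fun x y => facet y x || gradient x y.

Lemma arrow_step x y : arrow x y -> step x y.
Proof. by rewrite /step => /orP[/andP[->]|->]; rewrite ?orbT. Qed.

Lemma arrow_forward x y : arrow x y -> ~~ gradient y x.
Proof.
case/orP=> [/andP[]//|/gradient_facet/facet_dim E].
by apply/negP=> /gradient_facet/facet_dim; rewrite E; lia.
Qed.

Lemma step_arrow x y : step x y -> ~~ gradient y x -> arrow x y.
Proof. by rewrite /hasse_arrow => /orP[->->//|->]; rewrite orbT. Qed.

(** Every Morse arrow except perhaps a first one comes after a down step, by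
    [gradient_chain].  The second clause is the invariant for the induction: at
    the greatest possible height the path has just gone up. *)
Lemma path_rise x p : path step x p ->
  sdim (last x p) <= (sdim x).+1 /\
  (sdim (last x p) = (sdim x).+1 -> exists w, gradient w (last x p)).
Proof.
elim/last_ind: p => [|p y IH] /=; first by split; lia.
rewrite rcons_path last_rcons => /andP[/IH[le1 ex] /orP[d|g]].
  by have := facet_dim d; split; lia.
have E := facet_dim (gradient_facet g).
have ne : sdim (last x p) <> (sdim x).+1.
  by move=> /ex[w gw]; apply: gradient_chain gw g.
by split; [lia | move=> _; exists (last x p)].
Qed.

(** Without a double drop every down step but the last is undone by the next step,
    and the path ends at most one dimension below its start. *)
Lemma double_drop_exists x p :
  path step x p -> (sdim (last x p)).+2 <= sdim x ->
  exists p1 a b c p2, x :: p = p1 ++ [:: a, b, c & p2] /\ double_drop a b c.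
Proof.
have [n] := ubnP (size p); elim: n x p => // n IH x [|y [|z p]] /= ltn.
- by move=> _; lia.
- rewrite andbT => /orP[/facet_dim|/gradient_facet/facet_dim]; lia.
case/and3P=> /orP[dxy|gxy] syz pz le.
- case/orP: (syz) => [dyz|gyz].
    by exists [::], x, y, z, p; split=> //; apply/andP.
  have [|||p1 [a [b [c [p2 [E dd]]]]]] := IH z p.
  + by lia.
  + by [].
  + by move: (facet_dim dxy) (facet_dim (gradient_facet gyz)); lia.
  by exists [:: x, y & p1], a, b, c, p2; rewrite E.
have [|||p1 [a [b [c [p2 [E dd]]]]]] := IH y (z :: p).
- by rewrite /=; lia.
- by rewrite /= syz.
- by move: (facet_dim (gradient_facet gxy)) le => /=; lia.
by exists (x :: p1), a, b, c, p2; rewrite E.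
Qed.

Variables alpha gamma : {fset T}.
Hypothesis halpha : critical alpha.
Hypothesis hgamma : critical gamma.
Hypothesis hdim : sdim alpha = (sdim gamma).+2.

Local Notation flow := (is_flowline K f alpha gamma).

Lemma alpha_no_up t : gradient alpha t = false.
Proof.
by apply/negP=> g; have := critical_unpaired t halpha; rewrite /Defs.paired g.
Qed.

Lemma gamma_no_down t : gradient t gamma = false.
Proof.
apply/negP=> g; have := critical_unpaired t hgamma.
by rewrite /Defs.paired g orbT.
Qed.

Definition index2_path (P : seq {fset T}) :=
  [&& sorted step P, head gamma P == alpha & last alpha P == gamma].

(** The end of a double drop is the first simplex of its path whose dimension is
    that of [gamma].  By [path_rise] for the stretch from an earlier simplex to
    [a], that simplex is not lower than [b]; for the stretches from the second
    simplex to [a] and from [c] to [gamma], it shows that [a] is not above [alpha]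
    and [c] is not below [gamma].  This fixes the position of the double drop
    independently of its simplices. *)
Lemma double_drop_find p1 a b c p2 (P := p1 ++ [:: a, b, c & p2]) :
  index2_path P -> double_drop a b c ->
  find (fun x => (sdim x).+1 < sdim alpha) P = (size p1).+2.
Proof.
rewrite /P => /and3P[sP hP lP] /andP[/facet_dim Ea /facet_dim Eb].
have := sP; rewrite sorted_cat_cons => /and3P[sa _ /andP[_ pc]].
have le_gc : sdim gamma <= sdim c.
  have [] := path_rise pc; move: lP; rewrite last_cat /= => /eqP->.
  move=> le ex; rewrite leqNgt; apply/negP => lt.
  by case: ex => [|w]; [lia | rewrite gamma_no_down].
have le_aa : sdim a <= sdim alpha.
  case: (p1) hP sa => [/eqP <- //|x q /eqP /= -> ].
  rewrite -[a in sdim a](last_rcons alpha q); case: (rcons q a) => //= y r.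
  rewrite /step alpha_no_up orbF => /andP[/facet_dim E /path_rise[le_ry _]].
  by rewrite E.
have le_pa x : x \in p1 -> sdim a <= (sdim x).+1.
  move=> xp; case/splitPr: xp sa => q1 q2; rewrite rcons_cat rcons_cons.
  by rewrite sorted_cat_cons => /andP[_ /path_rise[]]; rewrite last_rcons.
have -> : p1 ++ [:: a, b, c & p2] = (p1 ++ [:: a; b]) ++ c :: p2.
  by rewrite -catA.
rewrite find_cat ifN.
  by rewrite /= ifT ?size_cat /=; lia.
apply/hasPn => x; rewrite mem_cat !inE -leqNgt.
by case/or3P => [/le_pa|/eqP->|/eqP->]; lia.
Qed.

Lemma double_drop_uniq p1 a b c p2 q1 a' b' c' q2 :
  index2_path (p1 ++ [:: a, b, c & p2]) ->
  double_drop a b c -> double_drop a' b' c' ->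
  p1 ++ [:: a, b, c & p2] = q1 ++ [:: a', b', c' & q2] ->
  [/\ q1 = p1, a' = a, b' = b, c' = c & q2 = p2].
Proof.
move=> iP dd dd' E; have := double_drop_find iP dd.
rewrite E in iP *; rewrite (double_drop_find iP dd') => -[/esym sz].
by have /eqP := E; rewrite eqseq_cat // => /andP[/eqP-> /eqP[-> -> -> ->]].
Qed.

(** * Near-flowlines and the floperations *)

(** The two steps of the double drop are down steps which need not be arrows. *)
Definition near_flowline_at p1 a b c p2 :=
  [&& double_drop a b c, head a p1 == alpha, sorted arrow (rcons p1 a),
      path arrow c p2 & last c p2 == gamma].

Lemma near_flowline_at_index2 p1 a b c p2 :
  near_flowline_at p1 a b c p2 -> index2_path (p1 ++ [:: a, b, c & p2]).
Proof.
case/and5P=> /andP[ba cb] h1 s1 s2 l2; apply/and3P; split.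
- rewrite sorted_cat_cons /= (sub_sorted arrow_step s1) /step ba cb /=.
  exact: sub_path arrow_step _ _ s2.
- by case: (p1) h1.
- by rewrite last_cat.
Qed.

Lemma is_flowlineE F : flow F =
  [&& sorted arrow F, head gamma F == alpha & last alpha F == gamma].
Proof.
rewrite /is_flowline halpha hgamma hdim eqxx /=; case: F => [|x p] /=.
  by apply/esym/andP => -[/eqP E]; move: hdim; rewrite E; lia.
by rewrite andbCA.
Qed.

Lemma flowline_legal F : flow F -> ~ illegal F.
Proof.
rewrite is_flowlineE => /and3P[sF _ _] [p1 [t [s [p2 [E g]]]]].
move: sF; rewrite E sorted_cat_cons => /and3P[_ /arrow_forward].
by rewrite g.
Qed.

Lemma near_flowline_at_legal p1 a b c p2 : near_flowline_at p1 a b c p2 ->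
  flow (p1 ++ [:: a, b, c & p2]) =
  ~~ gradient b a && ~~ gradient c b.
Proof.
move=> /and5P[/andP[ba cb] h1 s1 s2 l2].
rewrite is_flowlineE sorted_cat_cons s1 /= s2 last_cat l2 !andbT.
have -> : head gamma (p1 ++ [:: a, b, c & p2]) = head a p1 by case: (p1).
rewrite h1 andbT; apply/andP/andP => -[].
  by move=> /arrow_forward-> /arrow_forward->.
by move=> nb nc; rewrite !step_arrow // /step ?ba ?cb.
Qed.

Lemma near_flowline_at_illegal p1 a b c p2 : near_flowline_at p1 a b c p2 ->
  illegal (p1 ++ [:: a, b, c & p2]) -> gradient b a \/ gradient c b.
Proof.
move=> nP ill; apply/orP; apply/contraT => /norP[nb nc].
by case: (@flowline_legal _ _ ill); rewrite near_flowline_at_legal // nb.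
Qed.

Definition near_flowline (P : seq {fset T}) := exists p1 a b c p2,
  P = p1 ++ [:: a, b, c & p2] /\ near_flowline_at p1 a b c p2.

Lemma flowline_near F : flow F -> near_flowline F.
Proof.
rewrite is_flowlineE => /and3P[sF hF lF].
have [p1 [a [b [c [p2 [E dd]]]]]] : exists p1 a b c p2,
    F = p1 ++ [:: a, b, c & p2] /\ double_drop a b c.
  case: (F) sF hF lF => [_ /= /eqP E|x p /= pp /eqP xE /eqP lE].
    by move: hdim; rewrite -E; lia.
  rewrite xE in lE pp *; apply: double_drop_exists.
    exact: sub_path arrow_step _ _ pp.
  by rewrite lE hdim.
exists p1, a, b, c, p2; split=> //.
have hE : head a p1 = head gamma F by rewrite E; case: (p1).
have lE : last c p2 = last alpha F by rewrite E last_cat.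
move: sF; rewrite /near_flowline_at dd hE hF lE lF E sorted_cat_cons /=.
by case/and4P=> -> _ _ ->.
Qed.

Lemma near_flopE p1 a b c p2 Q : near_flowline_at p1 a b c p2 ->
  flop K (p1 ++ [:: a, b, c & p2]) Q ->
  exists b', [/\ b' != b, double_drop a b' c & Q = p1 ++ [:: a, b', c & p2]].
Proof.
move=> nP; have dd : double_drop a b c by case/andP: nP.
move E: (p1 ++ [:: a, b, c & p2]) => P fl.
case: fl E => q1 a' b0 c' q2 b' dd0 dd1 ne E.
have [<- <- <- <- <-] :=
    double_drop_uniq (near_flowline_at_index2 nP) dd dd0 E.
by exists b'.
Qed.

Lemma flop_sym P Q : flop K P Q -> flop K Q P.
Proof.
by case=> p1 a b c p2 b' d1 d2 ne; apply: Flop => //; rewrite eq_sym.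
Qed.

Lemma flop_size P Q : flop K P Q -> size Q = size P.
Proof. by case=> *; rewrite !size_cat. Qed.

Lemma flop_neq P : flop K P P -> False.
Proof.
move E: {2}P => Q fl; case: fl E => p1 a b c p2 b' _ _ ne /eqP.
rewrite eqseq_cat // !eqseq_cons !eqxx /= => /andP[/eqP E _].
by rewrite E eqxx in ne.
Qed.

Lemma flop_near P Q : near_flowline P -> flop K P Q -> near_flowline Q.
Proof.
move=> [p1 [a [b [c [p2 [-> nP]]]]]] /(near_flopE nP)[b' [_ dd ->]].
exists p1, a, b', c, p2; split=> //.
by move: nP; rewrite /near_flowline_at dd => /andP[].
Qed.

Lemma near_flop P : near_flowline P -> exists Q, flop K P Q.
Proof.
move=> [p1 [a [b [c [p2 [-> /andP[dd _]]]]]]].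
have [b' ne dd'] := double_drop_swap dd.
by exists (p1 ++ [:: a, b', c & p2]); apply: Flop.
Qed.

Lemma near_flop_inj P Q1 Q2 :
  near_flowline P -> flop K P Q1 -> flop K P Q2 -> Q1 = Q2.
Proof.
move=> [p1 [a [b [c [p2 [-> nP]]]]]].
move=> /(near_flopE nP)[b1 [n1 d1 ->]] /(near_flopE nP)[b2 [n2 d2 ->]].
have dd : double_drop a b c by case/andP: nP.
by rewrite (double_drop_swap_uniq dd d1 n1 d2 n2).
Qed.

Lemma near_insertE p1 a b c p2 Q : near_flowline_at p1 a b c p2 ->
  insert K f (p1 ++ [:: a, b, c & p2]) Q ->
  exists2 d, paired b d & Q = p1 ++ [:: a, b, d, b, c & p2].
Proof.
move=> nP; have dd : double_drop a b c by case/andP: nP.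
move E: (p1 ++ [:: a, b, c & p2]) => P ins.
case: ins E => q1 a' b0 c' q2 d dd0 pd E.
have [<- <- <- <- <-] :=
    double_drop_uniq (near_flowline_at_index2 nP) dd dd0 E.
by exists d.
Qed.

Lemma insert_size F P : insert K f F P -> size P = (size F).+2.
Proof. by case=> *; rewrite !size_cat /=; lia. Qed.

Lemma insert_inj F P1 P2 : flow F ->
  insert K f F P1 -> insert K f F P2 -> P1 = P2.
Proof.
move=> /flowline_near[p1 [a [b [c [p2 [-> nF]]]]]].
move=> /(near_insertE nF)[d1 pd1 ->] /(near_insertE nF)[d2 pd2 ->].
by rewrite (paired_inj pd1 pd2).
Qed.

Lemma insert_noncritical F P : flow F ->
  insert K f F P -> ~ critical_path K f F.
Proof.
move=> /flowline_near[p1 [a [b [c [p2 [-> nF]]]]]] /(near_insertE nF)[d pd _].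
case=> q1 [a' [b' [c' [q2 [E dd' cb]]]]].
have dd : double_drop a b c by case/andP: nF.
have [_ _ bE _ _] := double_drop_uniq (near_flowline_at_index2 nF) dd dd' E.
by rewrite -bE critical_unpaired in pd.
Qed.

(** The double drop of the new path uses the backward arrow of the inserted
    detour: it starts at [d] if [d] lies above [b], and ends at [d] if [d] lies
    below [b]. *)
Lemma insert_near F P : flow F -> insert K f F P ->
  [/\ near_flowline P, illegal P & cancel_pair K f P F].
Proof.
move=> flF; have [p1 [a [b [c [p2 [FE nF]]]]]] := flowline_near flF.
rewrite FE in flF *; move=> /(near_insertE nF)[d pd ->].
have /andP[dd _] := nF; have /andP[ba cb] := dd.
move: flF; rewrite near_flowline_at_legal // => /andP[nba ncb].
have /and5P[_ h1 s1 s2 l2] := nF.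
case/orP: pd => [bd|db].
- have dd' : double_drop d b c by rewrite /Defs.double_drop cb gradient_facet.
  split.
  + exists (p1 ++ [:: a; b]), d, b, c, p2; split; first by rewrite -catA.
    apply/and5P; split=> //; first by case: (p1) h1.
    rewrite -cats1 -catA sorted_cat_cons s1 /= /hasse_arrow bd orbT.
    by rewrite ba nba.
  + exists (p1 ++ [:: a; b]), d, b, (c :: p2); split=> //.
    by rewrite -catA.
  + rewrite -(cat_rcons a p1 [:: b, d, b, c & p2]).
    rewrite -(cat_rcons a p1 [:: b, c & p2]).
    exact: CancelFirst.
- have dd' : double_drop a b d by rewrite /Defs.double_drop ba gradient_facet.
  split.
  + exists p1, a, b, d, [:: b, c & p2]; split=> //.
    apply/and5P; split=> //=.
    by rewrite /hasse_arrow db orbT cb ncb.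
  + by exists (p1 ++ [:: a]), b, d, [:: b, c & p2]; rewrite -catA.
  + exact: CancelSecond.
Qed.

Lemma near_cancelE p1 a b c p2 F : near_flowline_at p1 a b c p2 ->
  cancel_pair K f (p1 ++ [:: a, b, c & p2]) F ->
  (exists q1, [/\ p1 = rcons q1 b, gradient b a & F = q1 ++ [:: b, c & p2]]) \/
  (exists q2, [/\ p2 = b :: q2, gradient c b & F = p1 ++ [:: a, b & q2]]).
Proof.
move=> nP; have dd : double_drop a b c by case/andP: nP.
move E: (p1 ++ [:: a, b, c & p2]) => P can.
case: can E => q1 a' b0 c' q2 dd0 g E; [left|right].
- have E' := E; rewrite -[RHS]cat_rcons in E'.
  have [<- <- <- <- <-] :=
    double_drop_uniq (near_flowline_at_index2 nP) dd dd0 E'.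
  by exists q1.
- have [<- <- <- <- <-] :=
    double_drop_uniq (near_flowline_at_index2 nP) dd dd0 E.
  by exists q2.
Qed.

Lemma near_cancel_inj P F1 F2 : near_flowline P ->
  cancel_pair K f P F1 -> cancel_pair K f P F2 -> F1 = F2.
Proof.
move=> [p1 [a [b [c [p2 [-> nP]]]]]].
case/(near_cancelE nP) => [[q1 [e1 g1 ->]]|[q1 [e1 g1 ->]]];
  case/(near_cancelE nP) => [[q2 [e2 g2 ->]]|[q2 [e2 g2 ->]]].
- by move: e2; rewrite e1 => /rcons_inj[->].
- by case: (gradient_chain g2 g1).
- by case: (gradient_chain g1 g2).
- by move: e2; rewrite e1 => -[->].
Qed.

(** The simplex [b] is in one pair only.  So the step of the double drop other than
    the cancelled backward arrow is legal, and the arrow on the far side of the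
    detour, not being a Morse arrow, goes down: with that step it forms the
    double drop of the shortened path. *)
Lemma cancel_flowline P F : near_flowline P -> cancel_pair K f P F ->
  flow F /\ insert K f F P.
Proof.
move=> [p1 [a [b [c [p2 [-> nP]]]]]].
have /and5P[/andP[ba cb] h1 s1 s2 l2] := nP.
case/(near_cancelE nP) => [[q1 [e1 g ->]]|[q2 [e2 g ->]]].
- move: h1 s1; rewrite e1; case/lastP: q1 {e1} => [|q1 x] h1 s1.
    by move: g; rewrite (eqP h1 : b = alpha) alpha_no_up.
  move: s1; rewrite -!cats1 -!catA /= sorted_cat_cons => /and4P[s1 xb _ _].
  have bx : facet b x.
    by case/orP: xb => [/andP[]|/gradient_chain/(_ g)].
  have ncb : ~~ gradient c b by apply/negP=> /gradient_chain/(_ g).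
  split.
    rewrite is_flowlineE sorted_cat_cons s1 /= xb s2 last_cat /= l2.
    rewrite step_arrow //= ?andbT; last by rewrite /step cb.
    by move: h1; case: (q1).
  apply: Insert; first by rewrite /Defs.double_drop bx.
  by rewrite /Defs.paired g.
- move: l2 s2; rewrite e2; case: q2 {e2} => [|y q2] l2 s2.
    by move: g; rewrite (eqP l2 : b = gamma) gamma_no_down.
  move: s2 => /= /and3P[_ by_ s2].
  have yb : facet y b.
    by case/orP: by_ => [/andP[]|/(gradient_chain g)].
  have nba : ~~ gradient b a by apply/negP=> /(gradient_chain g).
  split.
    rewrite is_flowlineE sorted_cat_cons s1 /= by_ s2 last_cat /=.
    rewrite step_arrow //= ?andbT; last by rewrite /step ba.
    by move: h1 l2 => /= + ->; case: (p1) => [|? ?] /= ->.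
  apply: Insert; first by rewrite /Defs.double_drop ba.
  by rewrite /Defs.paired g orbT.
Qed.

(** The backward arrow joins the intermediate simplex [b] to its partner, which is
    an end of the double drop and, not being critical, an inner simplex of the
    path.  The other step at the partner is not a down step, because it would give
    a second double drop; as a Morse arrow it joins the partner to [b]. *)
Lemma illegal_cancel P :
  near_flowline P -> illegal P -> exists F, cancel_pair K f P F.
Proof.
move=> [p1 [a [b [c [p2 [-> nP]]]]]] ill.
have /and5P[/andP[ba cb] h1 s1 s2 l2] := nP.
have dd : double_drop a b c by rewrite /Defs.double_drop ba.
have [g|g] := near_flowline_at_illegal nP ill.
- case/lastP: p1 h1 s1 nP {ill} => [|q1 x] h1 s1 nP.
    have := critical_unpaired b halpha.
    by rewrite -(eqP h1) /Defs.paired g orbT.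
  move: s1; rewrite -!cats1 -!catA /= sorted_cat_cons => /and3P[_ xa _].
  suff -> : x = b by exists (q1 ++ [:: b, c & p2]); apply: CancelFirst.
  case/orP: xa => [/andP[ax _]|ga]; last exact: gradient_down_inj ga g.
  (* if x -> a were a down step, x -> a -> b would be a second double drop *)
  have dd' : double_drop x a b by rewrite /Defs.double_drop ax.
  have [] :=
    double_drop_uniq (near_flowline_at_index2 nP) dd dd' (cat_rcons _ _ _).
  by move=> /(congr1 size); rewrite size_rcons; lia.
- case: p2 l2 s2 nP {ill} => [|y q2] l2 s2 nP.
    by have := critical_unpaired b hgamma; rewrite -(eqP l2) /Defs.paired g.
  have {s2} /andP[cy _] : arrow c y && path arrow y q2 by [].
  suff -> : y = b by exists (p1 ++ [:: a, b & q2]); apply: CancelSecond.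
  case/orP: cy => [/andP[yc _]|gy]; last exact: gradient_up_inj gy g.
  have dd' : double_drop b c y by rewrite /Defs.double_drop cb.
  have [] :=
    double_drop_uniq (near_flowline_at_index2 nP) dd dd' (esym (cat_rcons a _ _)).
  by move=> /(congr1 size); rewrite size_rcons; lia.
Qed.

Lemma legal_flowline P : near_flowline P -> ~ illegal P -> flow P.
Proof.
move=> [p1 [a [b [c [p2 [-> nP]]]]]] leg.
rewrite near_flowline_at_legal //; apply/andP; split; apply/negP=> g; apply: leg.
  by exists p1, a, b, (c :: p2).
by exists (rcons p1 a), b, c, p2; rewrite cat_rcons.
Qed.

(** * The two ends of a flowline *)

Definition opp_tag t := if t is tag_c then tag_f else tag_c.

(** The path from which the algorithm flops when it leaves an entry [(F, t)]. *)
Definition end_path t (F : seq {fset T}) : seq {fset T} -> Prop :=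
  if t is tag_c then eq F else insert K f F.

Lemma end_path_near t F P : flow F -> end_path t F P -> near_flowline P.
Proof.
case: t => flF /= => [<-|/(insert_near flF)[]//]; exact: flowline_near.
Qed.

Lemma end_path_inj t F P1 P2 : flow F ->
  end_path t F P1 -> end_path t F P2 -> P1 = P2.
Proof. by case: t => flF /=; [move=> <- | exact: insert_inj]. Qed.

Lemma near_end_path P : near_flowline P -> exists t F, flow F /\ end_path t F P.
Proof.
move=> nP; case: (pselect (illegal P)) => [ill|leg].
  have [F can] := illegal_cancel nP ill.
  by exists tag_f, F; apply: cancel_flowline.
by exists tag_c, P; split=> //; apply: legal_flowline.
Qed.

(** A flowline is legal and an inserted path is not, so no near-flowline is an end
    of both kinds; two flowlines with the same inserted path are both the result
    of the same Cancel. *)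
Lemma end_path_flowline t t' F F' P : flow F -> flow F' ->
  end_path t F P -> end_path t' F' P -> F = F'.
Proof.
move=> flF flF'; case: t; case: t' => /=.
- by move=> -> ->.
- by move=> <- /(insert_near flF')[_ /(flowline_legal flF)].
- by move=> + E; rewrite -E => /(insert_near flF)[_ /(flowline_legal flF')].
- move=> /(insert_near flF)[nP _ c1] /(insert_near flF')[_ _ c2].
  exact: near_cancel_inj nP c1 c2.
Qed.

Lemma first_appendedP P e : near_flowline P -> first_appended K f P e <->
  exists Q G t, [/\ e = (G, t), flop K P Q, flow G & end_path (opp_tag t) G Q].
Proof.
move=> nP; split.
  case=> [Q G fl ill can|Q fl leg].
    have [flG ins] := cancel_flowline (flop_near nP fl) can.
    by exists Q, G, tag_c.
  by exists Q, Q, tag_f; split=> //; apply: legal_flowline (flop_near nP fl) leg.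
case=> Q [G [[] [-> fl flG /=]]].
  move=> /(insert_near flG)[_ ill can]; exact: AppendedIllegal fl ill can.
by move=> E; rewrite E in flG *; apply: AppendedLegal fl (flowline_legal flG).
Qed.

(** An entry is left through the end named by its tag and was entered through the
    other one; this makes the algorithm reversible. *)
Lemma alg_nextP F t e : flow F -> alg_next K f (F, t) e <->
  exists P Q G t', [/\ e = (G, t'), end_path t F P, flop K P Q, flow G &
                       end_path (opp_tag t') G Q].
Proof.
move=> flF; split.
  move Ee: (F, t) => e0 nx; case: nx Ee => [P e'|P P' e' ncr ins] + [E1 E2].
    have nF := flowline_near flF.
    rewrite -E1 E2 => /(first_appendedP _ nF)[Q [G [t' [-> fl flG en]]]].
    by exists F, Q, G, t'.
  rewrite -E1 in ins; have [nP' _ _] := insert_near flF ins.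
  move=> /(first_appendedP _ nP')[Q [G [t' [-> fl flG en]]]].
  by rewrite E2; exists P', Q, G, t'.
case=> P [Q [G [t' [-> en fl flG en']]]].
have fa : first_appended K f P (G, t').
  by apply/first_appendedP; [exact: end_path_near en | exists Q, G, t'].
case: t en => /= [E|ins]; first by rewrite E; apply: NextC.
exact: NextF (insert_noncritical flF ins) ins fa.
Qed.

Definition end_edge t F G := exists P Q t',
  [/\ end_path t F P, flop K P Q, flow G & end_path t' G Q].

Lemma end_edge_sym t F G :
  flow F -> end_edge t F G -> exists t', end_edge t' G F.
Proof.
move=> flF [P [Q [t' [en fl flG en']]]]; exists t', Q, P, t; split=> //.
exact: flop_sym.
Qed.

Lemma end_edge_inj t F G1 G2 : flow F ->
  end_edge t F G1 -> end_edge t F G2 -> G1 = G2.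
Proof.
move=> flF [P1 [Q1 [t1 [en1 fl1 flG1 en1']]]].
move=> [P2 [Q2 [t2 [en2 fl2 flG2 en2']]]].
rewrite (end_path_inj flF en2 en1) in fl2.
rewrite (near_flop_inj (end_path_near flF en1) fl2 fl1) in en2'.
exact: end_path_flowline en1' en2'.
Qed.

(** The lengths of two distinct ends differ by two, so the same end would have to
    be its own flop. *)
Lemma end_edge_irr t F : flow F -> ~ end_edge t F F.
Proof.
move=> flF [P [Q [t' [en fl _ en']]]].
have E : t' = t.
  have := flop_size fl.
  by case: t t' en en' => -[] //= => [<- /insert_size->|/insert_size-> <-]; lia.
rewrite E in en'; have PQ := end_path_inj flF en en'.
by rewrite PQ in fl; apply: flop_neq fl.
Qed.

Lemma end_edge_exists F : flow F -> exists G, end_edge tag_c F G.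
Proof.
move=> flF; have nF := flowline_near flF; have [Q fl] := near_flop nF.
have [t [G [flG en]]] := near_end_path (flop_near nF fl).
by exists G, F, Q, t.
Qed.

Lemma end_edgeP F G : flow F -> flow G ->
  (exists t, end_edge t F G) <-> (exists t t', alg_next K f (F, t) (G, t')).
Proof.
move=> flF flG; split.
  case=> t [P [Q [t' [en fl _ en']]]]; exists t, (opp_tag t').
  apply/(alg_nextP _ _ flF); exists P, Q, G, (opp_tag t').
  by split=> //; case: (t') en'.
case=> t [t' /(alg_nextP _ _ flF)[P [Q [G' [t1 [[-> _] en fl flG' en']]]]]].
by exists t, P, Q, (opp_tag t1).
Qed.

(** The algorithm is continued from the second entry by choosing a successor as long
    as there is one. *)
Lemma alg_list_exists e0 e1 : alg_next K f e0 e1 ->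
  exists L, is_alg_list K f e0 L /\ L 1 = Some e1.
Proof.
move=> nx0; pose nxt e := match pselect (exists e', alg_next K f e e') with
  | left h => Some (sval (cid h)) | right _ => None end.
exists (fun i => if i is j.+1 then iter j (obind nxt) (Some e1) else Some e0).
split=> //; split=> // -[|i] //=.
case: (iter i (obind nxt) (Some e1)) => //= e; rewrite /nxt.
by case: pselect => // h; case: (cid h).
Qed.

(** Every entry may start a list of the algorithm: [(F, c)] always, and [(F, f)]
    when it has a successor, since then [F] is noncritical. *)
Lemma consecutive_end_edge (F G : flowline K f alpha gamma) :
  consecutive_flowlines F G <-> exists t, end_edge t (val F) (val G).
Proof.
rewrite (end_edgeP (valP F) (valP G)); split.
  case=> F0 [L [i [t [t' [HL Li Li1]]]]]; exists t, t'.
  by case: HL => [[_ /(_ i)]|[_ [_ /(_ i)]]]; rewrite Li Li1.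
case=> t [t' nx]; have [L [HL L1]] := alg_list_exists nx.
exists F, L, 0, t, t'; split=> //; last by case: HL.
case: t nx HL => nx HL; [by left | right; split=> //].
have [P [Q [G' [t1 [_ en _ _ _]]]]] := (alg_nextP _ _ (valP F)).1 nx.
exact: insert_noncritical (valP F) en.
Qed.

(** * The moduli space is a finite graph *)

(** The arrows decrease the values of [f] lexicographically, with the opposite of
    the dimension as second component. *)
Lemma arrow_path_uniq x p : path arrow x p -> uniq (x :: p).
Proof.
pose lex x y := (f y < f x)%R || (f y == f x) && (sdim x < sdim y).
have lex_tr : transitive lex.
  move=> z y w; rewrite /lex.
  case/orP=> [lt1|/andP[/eqP-> d1]] /orP[lt2|/andP[/eqP-> d2]].
  - by rewrite (lt_trans lt2 lt1).
  - by rewrite lt1.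
  - by rewrite lt2.
  - by rewrite eqxx (ltn_trans d1 d2) orbT.
have lex_irr : irreflexive lex by move=> z; rewrite /lex ltxx ltnn andbF.
move=> pp; apply: (sorted_uniq lex_tr lex_irr).
apply: sub_path pp => y z; rewrite /hasse_arrow /lex.
case/orP=> [/andP[zy]|/andP[yz le]].
  by rewrite /Defs.gradient zy -ltNge => ->.
by rewrite (facet_dim yz) ltnSn andbT orbC -le_eqVlt.
Qed.

Fixpoint words (n : nat) : seq (seq {fset T}) :=
  if n is m.+1 then
    [::] :: [seq x :: s | x <- enum_fset K, s <- words m] else [:: [::]].

Lemma mem_words n s : all [in K] s -> size s <= n -> s \in words n.
Proof.
elim: n s => [|n IH] [|x s] //=.
case/andP=> xK sK le; rewrite inE; apply/orP; right.
by apply: (allpairs_f cons) => //; apply: IH.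
Qed.

Lemma flowlines_finite :
  exists V : seq (flowline K f alpha gamma), forall F, F \in V.
Proof.
exists (pmap insub (words #|` K|)) => F; rewrite mem_pmap_sub.
have := valP F; rewrite is_flowlineE; case: (val F) => [|x p] /=.
  by case/andP=> /eqP E; move: hdim; rewrite E; lia.
case/and3P=> pp /eqP xE _.
have allK : all [in K] (x :: p).
  have xK : x \in K by rewrite xE; case/andP: halpha.
  move: pp xK {xE}; elim: p x => [|y p IH] x /=; first by move=> _ ->.
  case/andP=> xy pp ->; apply: IH => //.
  by case/orP: xy => [/andP[/facetP[]]|/gradient_facet/facetP[]].
apply: mem_words => //; apply: uniq_leq_size; first exact: arrow_path_uniq.
by move=> y /(allP allK).
Qed.

Definition moduli_edge (F G : flowline K f alpha gamma) : bool :=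
  `[< exists t, end_edge t (val F) (val G) >].

Lemma moduli_edge_sym : symmetric moduli_edge.
Proof.
by move=> F G; apply/asboolP/asboolP => -[t];
  [apply: end_edge_sym (valP F)|apply: end_edge_sym (valP G)].
Qed.

Lemma moduli_edge_irr : irreflexive moduli_edge.
Proof. by move=> F; apply/asboolP => -[t]; apply: end_edge_irr (valP F). Qed.

Lemma moduli_edge_deg_gt0 F : exists G, moduli_edge F G.
Proof.
have [G ed] := end_edge_exists (valP F); have [P [Q [t [_ _ flG _]]]] := ed.
by exists (Sub G flG); apply/asboolP; exists tag_c; rewrite SubK.
Qed.

(** A neighbour is determined by the end that leads to it, and there are two
    tags. *)
Lemma moduli_edge_deg_le2 F G1 G2 G3 :
  moduli_edge F G1 -> moduli_edge F G2 -> moduli_edge F G3 ->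
  [|| G1 == G2, G1 == G3 | G2 == G3].
Proof.
move=> /asboolP[t1 d1] /asboolP[t2 d2] /asboolP[t3 d3].
have same t (G G' : flowline K f alpha gamma) :
    end_edge t (val F) (val G) -> end_edge t (val F) (val G') -> G == G'.
  by move=> d d'; apply/eqP/val_inj/(end_edge_inj (valP F) d d').
have [E|E|E] : [\/ t1 = t2, t1 = t3 | t2 = t3].
  by case: (t1) (t2) (t3) => -[] [];
    by [constructor 1 | constructor 2 | constructor 3].
- by rewrite E in d1; rewrite (same _ _ _ d1 d2).
- by rewrite E in d1; rewrite (same _ _ _ d1 d3) orbT.
- by rewrite E in d2; rewrite (same _ _ _ d2 d3) !orbT.
Qed.

Lemma moduli_space_graph (V : seq (flowline K f alpha gamma)) s :
  (forall F, F \in V) -> moduli_space s <-> graph_complex moduli_edge V s.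
Proof.
move=> allV; split=> [[[F ->]|[F [G [/consecutive_end_edge ed ->]]]]|].
- by left; exists F.
- by right; exists F, G; split=> //; apply/asboolP.
case=> [[F _ ->]|[F [G [_ /asboolP/consecutive_end_edge ed ->]]]].
- by left; exists F.
- by right; exists F, G.
Qed.

End MorsePaths.

Theorem lemma4p3 (R : realType) (T : choiceType) (K : {fset {fset T}})
    (f : {fset T} -> R) (n : nat) (alpha gamma : {fset T})
    (hK : simplicial_complex (fun s => s \in K))
    (hf : discrete_morse K f)
    (hn : (0 < n)%N)
    (halpha : critical K f alpha) (hdim_alpha : sdim alpha = n.+1)
    (hgamma : critical K f gamma) (hdim_gamma : sdim gamma = n.-1) :
  simplicial_1manifold_with_boundary (@moduli_space R T K f alpha gamma) /\
  disjoint_union_of_paths_and_cycles (@moduli_space R T K f alpha gamma).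
Proof.
have hdim : sdim alpha = (sdim gamma).+2 by rewrite hdim_alpha hdim_gamma; lia.
have [V allV] := flowlines_finite hK halpha hgamma hdim.
have -> : @moduli_space R T K f alpha gamma =
    graph_complex (@moduli_edge R T K f alpha gamma) V.
  by apply/funext => s; apply/propext; apply: moduli_space_graph.
have esym := moduli_edge_sym (K := K) (f := f) (alpha := alpha) (gamma := gamma).
have eirr := moduli_edge_irr hK hf halpha hgamma hdim.
have edeg0 := moduli_edge_deg_gt0 hK hf halpha hgamma hdim.
have edeg2 := moduli_edge_deg_le2 hK hf halpha hgamma hdim.
have clV : edge_closed (@moduli_edge R T K f alpha gamma) V.
  by move=> *; apply: allV.
split; first exact: graph_complex_1manifold.
have [ps [cs [ps2 cs3 uq _ E]]] :=
  graph_complex_decomposition esym eirr edeg0 edeg2 clV.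
by exists ps, cs.
Qed.
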